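(* Let $P=(X,\prec)$ be a finite poset of width two with a fixed partition $X=\mathcal{C}_1\sqcup\mathcal{C}_2$ into chains $\mathcal{C}_1=\{\alpha_1\prec\cdots\prec\alpha_{a}\}$, $\mathcal{C}_2=\{\beta_1\prec\cdots\prec\beta_{b}\}$, and let $x\in\mathcal{C}_1$. Let $\mathbf{q}=(q_1,\dots,q_a)$ be formal variables and define $$N_{\mathbf{q}}(k):=\sum_{L\in\mathcal{E}(P)\,:\,L(x)=k}\mathbf{q}^L.$$ Then $N_{\mathbf{q}}(k)^2\geqslant N_{\mathbf{q}}(k-1)\,N_{\mathbf{q}}(k+1)$ for all $k>1$, where the inequality between polynomials in $q_1,\dots,q_a$ is coefficient-wise.
   Context: $\mathcal{E}(P)$ is the set of linear extensions of $P$, i.e. bijections $L:X\to\{1,\dots,|X|\}$ with $L(u)<L(v)$ whenever $u\prec v$. The multivariate weight of $L$ is $\mathbf{q}^L:=\prod_{i=1}^{a}q_i^{L(\alpha_i)-L(\alpha_{i-1})}$ with the convention $L(\alpha_0):=0$. *)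

(* Defs.v *)
From HB Require Import structures.
From mathcomp Require Import all_boot all_order all_algebra.
From mathcomp Require Import mpoly.
Set Implicit Arguments.
Unset Strict Implicit.
Unset Printing Implicit Defensive.

Import Order.TTheory GRing.Theory Num.Theory.
Local Open Scope ring_scope.

Section Posets.
Variables (d : Order.disp_t) (X : finPOrderType d).

Definition antichain (A : {set X}) : bool :=
  [forall u in A, forall v in A, (u >=< v)%O ==> (u == v)].

Definition width : nat := (\max_(A : {set X} | antichain A) #|A|)%N.

(* A bijection X -> {1, ..., |X|} is stored as a bijection into 'I_#|X|;
   the 1-based value L(u) is [pos L u]. *)
Definition pos (L : {ffun X -> 'I_#|X|}) (u : X) : nat := (L u).+1.

Definition linear_extension (L : {ffun X -> 'I_#|X|}) : bool :=
  [&& injectiveb L,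
      [forall i : 'I_#|X|, exists u, L u == i]
    & [forall u, forall v, (u < v)%O ==> (pos L u < pos L v)%N]].

(* The element alpha_j of the chain is [nth _ alpha j.-1], and
   [chain_pos alpha L j] is L(alpha_j) for 1 <= j <= a, with L(alpha_0) = 0. *)
Definition chain_pos (a : nat) (alpha : a.-tuple X)
    (L : {ffun X -> 'I_#|X|}) (j : nat) : nat :=
  nth 0%N (0%N :: [seq pos L u | u <- alpha]) j.

(* The variable 'X_i, with i : 'I_a counted from 0, is q_(i+1).  The truncated
   subtraction is exact: L is increasing along the chain alpha. *)
Definition qweight (a : nat) (alpha : a.-tuple X)
    (L : {ffun X -> 'I_#|X|}) : {mpoly int[a]} :=
  \prod_(i < a) 'X_i ^+ (chain_pos alpha L i.+1 - chain_pos alpha L i)%N.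

Definition Nq (a : nat) (alpha : a.-tuple X) (x : X) (k : nat) :
    {mpoly int[a]} :=
  \sum_(L : {ffun X -> 'I_#|X|} | linear_extension L && (pos L x == k))
     qweight alpha L.

End Posets.

Definition coef_le (a : nat) (p q : {mpoly int[a]}) : Prop :=
  forall m : 'X_{1..a}, p@_m <= q@_m.

(* Main.v *)
Require Import Defs.
From HB Require Import structures.
From mathcomp Require Import all_boot all_order all_algebra.
From mathcomp Require Import mpoly.
From mathcomp Require Import zify.
Set Implicit Arguments.
Unset Strict Implicit.
Unset Printing Implicit Defensive.
Import Order.TTheory GRing.Theory Num.Theory.
Local Open Scope ring_scope.

(** A linear extension [L] is determined by its heights [h i], the number of
    elements of the second chain placed below [alpha_i]; heights are exactly the
    nondecreasing sequences subject to a lower and an upper bound at each [i].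
    Since [L(alpha_i) = i + h i], the monomial of a product of two weights
    determines, and is determined by, the sum of the two height sequences.  So
    for a fixed sum one has to inject the pairs [(h, h')] with
    [(h s, h' s) = (c - 1, c + 1)] into those with [(h s, h' s) = (c, c)].
    Reflect [(h, h')] to [(h' - 1, h + 1)] on the largest interval around [s]
    with no step inside at which one could pass between the reflected and the
    original pair without losing monotonicity.  The reflection does not change
    which steps allow such a passage, hence it is an involution; and [h' - h]
    stays at least 2 on the interval, so the bounds are preserved. *)

(** * Counting tools: injections given by relations, predicates true on an initial segment *)

(** A relation replaces the injection because the image of a pair of linear extensions is described
    only by its heights; [f] picks one such image. *)
Lemma leq_card_rel (S T : finType) (A : {pred S}) (B : {pred T})
    (R : S -> T -> bool) :
    (forall x, x \in A -> exists2 y, y \in B & R x y) ->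
    (forall x x' y, x \in A -> x' \in A -> R x y -> R x' y -> x = x') ->
  (#|A| <= #|B|)%N.
Proof.
move=> exR injR.
have exB x : x \in A -> exists y, (y \in B) && R x y.
  by move=> /exR[y By Rxy]; exists y; rewrite By.
case: (pickP (mem B)) => [y0 _|B0]; last first.
  rewrite [#|A|]eq_card0 // => x; apply/negP => /exR[y By _].
  by have := B0 y; rewrite /= By.
pose f x := odflt y0 [pick y in B | R x y].
have fP x : x \in A -> (f x \in B) && R x (f x).
  move=> /exB[y Py]; rewrite /f; case: pickP => [//|/(_ y)].
  by rewrite Py.
have f_inj : {in A &, injective f}.
  move=> x x' Ax Ax' eqf; have /andP[_ Rx] := fP x Ax.
  have /andP[_ Rx'] := fP x' Ax'; apply: injR Ax Ax' Rx _.
  by rewrite eqf.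
rewrite -(card_in_image f_inj); apply: subset_leq_card.
by apply/subsetP => _ /imageP[x Ax ->]; case/andP: (fP x Ax).
Qed.

Lemma nth_count_initial (T : Type) (x0 : T) (P : pred T) (s : seq T) :
    (forall i j, (i < j < size s)%N -> P (nth x0 s j) -> P (nth x0 s i)) ->
  forall j, (j < size s)%N -> P (nth x0 s j) = (j < count P s)%N.
Proof.
elim: s => [//|y s IHs] decP j ltj /=.
case Py: (P y); last first.
  have -> : count P s = 0%N.
    apply/eqP; rewrite -leqn0 leqNgt -has_count; apply/negP => /(has_nthP x0).
    by move=> [i lti Pi]; have := decP 0%N i.+1; rewrite /= ltnS lti Pi Py => /(_ isT isT).
  case: j ltj => [|j] ltj //=; apply/negP => Pj.
  by have := decP 0%N j.+1; rewrite ltj /= Py => /(_ isT Pj).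
case: j ltj => [|j] ltj //=; rewrite add1n ltnS; apply: IHs => // i i' lti.
exact: (decP i.+1 i'.+1).
Qed.

Lemma count_nth_initial (T : Type) (x0 : T) (P : pred T) (s : seq T) n :
    (n <= size s)%N ->
    (forall j, (j < size s)%N -> P (nth x0 s j) = (j < n)%N) ->
  count P s = n.
Proof.
elim: s n => [|y s IHs] n /= len PE; first by lia.
have /= -> := PE 0%N isT.
case: n len PE => [|n] len PE.
  by rewrite (IHs 0%N) // => j ltj; have := PE j.+1 ltj.
by rewrite (IHs n) // => j ltj; have := PE j.+1 ltj.
Qed.

(** * Reflection of a pair of monotone sequences *)

Section Reflection.
Variables (n s : nat).
Hypothesis lt_sn : (s < n)%N.

(** Monotonicity of both sequences across the step from [i] to [i.+1] when exactly one end is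
    reflected. Entering and leaving the reflected interval give the same two inequalities. *)
Definition switchable (h h' : nat -> nat) i : bool :=
  (h' i <= (h i.+1).+1)%N && (h i < h' i.+1)%N.

(** Truncated subtraction empties the first list if [j <= s] and the second if [s <= j], so exactly
    the steps between [s] and [j] are tested. *)
Definition reflected (h h' : nat -> nat) j : bool :=
  all (fun i => ~~ switchable h h' i) (iota s (j - s)) &&
  all (fun i => ~~ switchable h h' i) (iota j (s - j)).

Definition reflect_lo (h h' : nat -> nat) j : nat :=
  if reflected h h' j then (h' j).-1 else h j.

Definition reflect_hi (h h' : nat -> nat) j : nat :=
  if reflected h h' j then (h j).+1 else h' j.

Lemma reflected_center h h' : reflected h h' s.
Proof. by rewrite /reflected subnn. Qed.

Lemma reflected_right h h' i : (s <= i)%N ->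
  reflected h h' i.+1 = reflected h h' i && ~~ switchable h h' i.
Proof.
move=> le_si; rewrite /reflected.
have /eqP-> : (s - i == 0)%N by lia.
have /eqP-> : (s - i.+1 == 0)%N by lia.
have -> : (i.+1 - s = (i - s) + 1)%N by lia.
by rewrite iotaD all_cat /= !andbT subnKC.
Qed.

Lemma reflected_left h h' i : (i < s)%N ->
  reflected h h' i = ~~ switchable h h' i && reflected h h' i.+1.
Proof.
move=> lt_is; rewrite /reflected.
have /eqP-> : (i - s == 0)%N by lia.
have /eqP-> : (i.+1 - s == 0)%N by lia.
by have -> : (s - i = (s - i.+1).+1)%N by lia.
Qed.

Lemma reflected_step h h' i : ~~ switchable h h' i ->
  reflected h h' i.+1 = reflected h h' i.
Proof.
move=> nsw; case: (leqP s i) => [le_si|lt_is].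
  by rewrite reflected_right // nsw andbT.
by rewrite [RHS]reflected_left // nsw.
Qed.

Variables h h' : nat -> nat.
Hypothesis monoh : forall i, (i.+1 < n)%N -> (h i <= h i.+1)%N.
Hypothesis monoh' : forall i, (i.+1 < n)%N -> (h' i <= h' i.+1)%N.
Hypothesis gap_s : ((h s).+2 <= h' s)%N.

(** Induction away from [s]. The gap at one end of a step and monotonicity give [h i < h' i.+1]; a
    step that is not switchable must then have [h' i >= h i.+1 + 2], and monotonicity carries the
    gap to the other end. In particular the predecessor in [reflect_lo] is never truncated. *)
Lemma reflected_gap j : (j < n)%N -> reflected h h' j -> ((h j).+2 <= h' j)%N.
Proof.
case: (leqP s j) => [le_sj|/ltnW le_js].
  rewrite -(subnKC le_sj); elim: (j - s)%N => [|d IHd]; first by rewrite addn0.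
  rewrite addnS => ltn; rewrite reflected_right ?leq_addr //.
  move=> /andP[/(IHd (ltnW ltn)) gap]; rewrite /switchable.
  by have := monoh ltn; have := monoh' ltn; lia.
move=> _; rewrite -(subKn le_js).
elim: (s - j)%N (leq_subr j s) => [|d IHd] led; first by rewrite subn0.
rewrite reflected_left; last by lia.
have e : ((s - d.+1).+1 = s - d)%N by lia.
rewrite e => /andP[+ /(IHd (ltnW led)) gap]; rewrite /switchable e.
have ltn : ((s - d.+1).+1 < n)%N by lia.
have := monoh ltn; have := monoh' ltn; rewrite e; lia.
Qed.

(** If both or neither of [i], [i.+1] are reflected, monotonicity is inherited. Otherwise the step
    is switchable by [reflected_step], which is what is required. *)
Lemma reflect_mono i : (i.+1 < n)%N ->
  (reflect_lo h h' i <= reflect_lo h h' i.+1)%N /\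
  (reflect_hi h h' i <= reflect_hi h h' i.+1)%N.
Proof.
move=> ltn; have := monoh ltn; have := monoh' ltn.
have := @reflected_gap i (ltnW ltn); have := reflected_gap ltn.
have := @reflected_step h h' i; rewrite /reflect_lo /reflect_hi /switchable.
case: (reflected h h' i); case: (reflected h h' i.+1); lia.
Qed.

(** Reflecting both ends exchanges the two inequalities of [switchable]. At a boundary of the
    interval the step is switchable before, and also after, by monotonicity of [h] and [h']. *)
Lemma switchable_reflect i : (i.+1 < n)%N ->
  switchable (reflect_lo h h') (reflect_hi h h') i = switchable h h' i.
Proof.
move=> ltn; have := monoh ltn; have := monoh' ltn.
have := @reflected_gap i (ltnW ltn); have := reflected_gap ltn.
have := @reflected_step h h' i; rewrite /switchable /reflect_lo /reflect_hi.
case: (reflected h h' i); case: (reflected h h' i.+1); lia.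
Qed.

Lemma reflected_reflect j : (j < n)%N ->
  reflected (reflect_lo h h') (reflect_hi h h') j = reflected h h' j.
Proof.
move=> ltn; rewrite /reflected; congr (_ && _); apply: eq_in_all => i;
  rewrite mem_iota => lti; congr (~~ _); apply: switchable_reflect; lia.
Qed.

End Reflection.

Lemma reflected_eq n s h h' g g' j : (s < n)%N -> (j < n)%N ->
    {in gtn n, h =1 g} -> {in gtn n, h' =1 g'} ->
  reflected s h h' j = reflected s g g' j.
Proof.
move=> lt_sn lt_jn eqh eqh'; rewrite /reflected; congr (_ && _);
  apply: eq_in_all => i; rewrite mem_iota /switchable => lti;
  rewrite !eqh ?eqh' // inE; lia.
Qed.

(** The interval can be read off the image by [reflected_reflect]; once it is known, each value is
    recovered by undoing the shift. *)
Lemma reflect_inj n s h h' g g' : (s < n)%N ->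
    (forall i, (i.+1 < n)%N -> (h i <= h i.+1)%N) ->
    (forall i, (i.+1 < n)%N -> (h' i <= h' i.+1)%N) ->
    (forall i, (i.+1 < n)%N -> (g i <= g i.+1)%N) ->
    (forall i, (i.+1 < n)%N -> (g' i <= g' i.+1)%N) ->
    ((h s).+2 <= h' s)%N -> ((g s).+2 <= g' s)%N ->
    {in gtn n, reflect_lo s h h' =1 reflect_lo s g g'} ->
    {in gtn n, reflect_hi s h h' =1 reflect_hi s g g'} ->
  forall j, (j < n)%N -> h j = g j /\ h' j = g' j.
Proof.
move=> lt_sn mh mh' mg mg' gaph gapg eqlo eqhi j lt_jn.
have eqr : reflected s h h' j = reflected s g g' j.
  rewrite -(reflected_reflect lt_sn mh mh' gaph lt_jn).
  rewrite -(reflected_reflect lt_sn mg mg' gapg lt_jn).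
  exact: reflected_eq lt_sn lt_jn eqlo eqhi.
have := eqlo j lt_jn; have := eqhi j lt_jn.
have := reflected_gap lt_sn mh mh' gaph lt_jn.
have := reflected_gap lt_sn mg mg' gapg lt_jn.
rewrite /reflect_lo /reflect_hi eqr; case: (reflected s g g' j); lia.
Qed.

(** * Linear extensions as height sequences *)

Section Ranks.
Variables (d : Order.disp_t) (X : finPOrderType d).
Implicit Types (L : {ffun X -> 'I_#|X|}) (u v : X).

Lemma linear_extension_inj L : linear_extension L -> injective L.
Proof. by move=> /and3P[/injectiveP]. Qed.

Lemma linear_extension_lt L u v :
  linear_extension L -> (u < v)%O -> (L u < L v)%N.
Proof. by move=> /and3P[_ _ /forallP/(_ u)/forallP/(_ v)/implyP]. Qed.

Lemma linear_extension_rank L u :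
  linear_extension L -> #|[pred v | (L v < L u)%N]| = L u.
Proof.
move=> LE; have Linj := linear_extension_inj LE.
rewrite -(card_image Linj).
transitivity #|[pred i : 'I_#|X| | (i < L u)%N]|.
  apply: eq_card => i; rewrite !inE; apply/imageP/idP => [[v]|lti].
    by rewrite inE => ltv ->.
  case/and3P: LE => _ /forallP/(_ i)/existsP[v /eqP Lv] _.
  by exists v; rewrite ?inE Lv.
rewrite -sum1_card.
rewrite -(big_ord_widen _ (fun=> 1%N)) ?sum1_card ?card_ord //.
exact/ltnW/ltn_ord.
Qed.

(** Ranking by [key] allows a linear extension to be built from comparisons alone, with keys that
    need not be consecutive. *)
Lemma linear_extension_of_key (key : X -> nat) : injective key ->
    (forall u v, (u < v)%O -> (key u < key v)%N) ->
  exists2 L, linear_extension L &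
    forall u, L u = #|[pred v | (key v < key u)%N]| :> nat.
Proof.
move=> key_inj key_lt.
have rank_ltn u : (#|[pred v | (key v < key u)%N]| < #|X|)%N.
  rewrite [leqRHS](cardD1 u) inE add1n ltnS; apply: subset_leq_card.
  apply/subsetP => v; rewrite !inE andbT => ltv.
  by apply/eqP => eq_vu; rewrite eq_vu ltnn in ltv.
have rank_lt u v : (key u < key v)%N ->
    (#|[pred w | (key w < key u)%N]| < #|[pred w | (key w < key v)%N]|)%N.
  move=> lt_uv; apply: proper_card; apply/properP; split.
    by apply/subsetP => w; rewrite !inE => /ltn_trans; apply.
  by exists u; rewrite !inE ?ltnn.
pose L := [ffun u => Ordinal (rank_ltn u)].
have L_inj : injective L.
  move=> u v; rewrite !ffunE => /(congr1 val) /= eq_r; apply: key_inj.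
  by case: (ltngtP (key u) (key v)) => // /rank_lt; rewrite eq_r ltnn.
exists L; last by move=> u; rewrite ffunE.
apply/and3P; split; first exact/injectiveP.
  have /(inj_card_bij L_inj)[f _ fK] : (#|{: 'I_#|X| }| <= #|X|)%N by rewrite card_ord.
  by apply/forallP => i; apply/existsP; exists (f i); rewrite fK.
apply/forallP => u; apply/forallP => v; apply/implyP => /key_lt lt_uv.
by rewrite /pos !ffunE /= ltnS; apply: rank_lt.
Qed.

End Ranks.

Section Heights.
Variables (d : Order.disp_t) (X : finPOrderType d) (a b : nat).
Variables (alpha : a.-tuple X) (beta : b.-tuple X) (x : X).
Hypothesis halpha : sorted (fun u v : X => (u < v)%O) alpha.
Hypothesis hbeta : sorted (fun u v : X => (u < v)%O) beta.
Hypothesis hcover : [set: X] = [set u in alpha] :|: [set u in beta].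
Hypothesis hdisj : [disjoint [set u in alpha] & [set u in beta]].
Implicit Types (L : {ffun X -> 'I_#|X|}) (u v : X).

Local Notation A := (nth x alpha).
Local Notation B := (nth x beta).

Lemma alpha_lt i j : (i < j)%N -> (j < a)%N -> (A i < A j)%O.
Proof.
move=> ltij ltj; apply: (sorted_ltn_nth lt_trans x halpha) => //;
  rewrite inE size_tuple //; exact: ltn_trans ltj.
Qed.

Lemma beta_lt i j : (i < j)%N -> (j < b)%N -> (B i < B j)%O.
Proof.
move=> ltij ltj; apply: (sorted_ltn_nth lt_trans x hbeta) => //;
  rewrite inE size_tuple //; exact: ltn_trans ltj.
Qed.

Lemma notin_alpha u : (u \notin alpha) = (u \in beta).
Proof.
have := in_setT u; rewrite hcover !inE.
case ua: (u \in alpha); case ub: (u \in beta) => //= _.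
by move/pred0P/(_ u): hdisj; rewrite /= !inE ua ub.
Qed.

Lemma chain_cases u :
  (exists2 i, (i < a)%N & u = A i) \/ (exists2 j, (j < b)%N & u = B j).
Proof.
case ua: (u \in alpha); [left | right].
  by exists (index u alpha); rewrite ?nth_index // -[ltnRHS](size_tuple alpha) index_mem.
have ub : u \in beta by rewrite -notin_alpha ua.
by exists (index u beta); rewrite ?nth_index // -[ltnRHS](size_tuple beta) index_mem.
Qed.

Lemma card_chains (P : pred X) : #|P| = (count P alpha + count P beta)%N.
Proof.
rewrite -count_cat cardE -size_filter /enum_mem.
apply/perm_size; apply: perm_filter; rewrite -enumT.
apply: uniq_perm; first exact: enum_uniq.
  rewrite cat_uniq !(lt_sorted_uniq, halpha, hbeta) //= andbT.
  by apply/hasPn => u; rewrite -notin_alpha.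
by move=> u; rewrite mem_enum mem_cat -notin_alpha orbN.
Qed.

Definition height L i : nat := count (fun v => L v < L (A i))%N beta.

(** Apart from monotonicity, all conditions are bounds on single values, so they can be checked
    index by index after a reflection. *)
Definition admissible (h : nat -> nat) : Prop :=
  [/\ forall i, (i.+1 < a)%N -> (h i <= h i.+1)%N,
      forall i, (i < a)%N -> (h i <= b)%N,
      forall i j, (i < a)%N -> (j < b)%N -> (B j < A i)%O -> (j < h i)%N
    & forall i j, (i < a)%N -> (j < b)%N -> (A i < B j)%O -> (h i <= j)%N].

Section OneExtension.
Variable L : {ffun X -> 'I_#|X|}.
Hypothesis LE : linear_extension L.

Lemma ltn_alpha i j : (i < a)%N -> (j < a)%N -> (L (A i) < L (A j))%N = (i < j)%N.
Proof.
move=> lti ltj; case: (ltngtP i j) => [lt_ij|lt_ji|->]; last by rewrite ltnn.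
  exact/(linear_extension_lt LE)/alpha_lt.
have := linear_extension_lt LE (alpha_lt lt_ji lti); lia.
Qed.

Lemma ltn_beta i j : (i < b)%N -> (j < b)%N -> (L (B i) < L (B j))%N = (i < j)%N.
Proof.
move=> lti ltj; case: (ltngtP i j) => [lt_ij|lt_ji|->]; last by rewrite ltnn.
  exact/(linear_extension_lt LE)/beta_lt.
have := linear_extension_lt LE (beta_lt lt_ji lti); lia.
Qed.

Lemma ltn_beta_alpha i j : (j < b)%N -> (L (B j) < L (A i))%N = (j < height L i)%N.
Proof.
move=> ltj; rewrite /height.
apply: (@nth_count_initial _ x (fun v => L v < L (A i))%N);
  rewrite size_tuple // => j1 j2 /andP[lt12 lt2]; apply: ltn_trans.
by rewrite ltn_beta // (ltn_trans lt12).
Qed.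

Lemma alpha_neq_beta i j : (i < a)%N -> (j < b)%N -> A i != B j.
Proof.
move=> lti ltj; apply/eqP => eqAB.
have : A i \in beta by rewrite eqAB mem_nth ?size_tuple.
by rewrite -notin_alpha mem_nth ?size_tuple.
Qed.

Lemma ltn_alpha_beta i j : (i < a)%N -> (j < b)%N ->
  (L (A i) < L (B j))%N = (height L i <= j)%N.
Proof.
move=> lti ltj; rewrite [RHS]leqNgt -ltn_beta_alpha // -leqNgt [RHS]leq_eqVlt.
case: eqP => // eqL; have := alpha_neq_beta lti ltj.
by rewrite (linear_extension_inj LE (ord_inj eqL)) eqxx.
Qed.

(** The rank of [A i] counts the [i] earlier elements of its own chain and the [height L i] elements
    of the other; ranks and indices start at 0. *)
Lemma linear_extension_height i : (i < a)%N -> L (A i) = (i + height L i)%N :> nat.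
Proof.
move=> lti; rewrite -{1}(linear_extension_rank (A i) LE) card_chains; congr (_ + _)%N.
apply: (@count_nth_initial _ x); rewrite size_tuple ?(ltnW lti) //= => j ltj.
exact: ltn_alpha.
Qed.

Lemma height_admissible : admissible (height L).
Proof.
split=> [i lti|i lti|i j lti ltj ltBA|i j lti ltj ltAB].
- apply: sub_count => v /= /ltn_trans; apply.
  by rewrite ltn_alpha // (ltn_trans _ lti).
- by rewrite -[leqRHS](size_tuple beta) count_size.
- by rewrite -ltn_beta_alpha // linear_extension_lt.
- by rewrite -ltn_alpha_beta // linear_extension_lt.
Qed.

End OneExtension.

(** Heights decide every comparison between the chains, and comparisons within a chain are forced;
    comparisons determine ranks. *)
Lemma height_inj L L' : linear_extension L -> linear_extension L' ->
  (forall i, (i < a)%N -> height L i = height L' i) -> L = L'.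
Proof.
move=> LE LE' eqh; apply/ffunP => u; apply/val_inj => /=.
rewrite -(linear_extension_rank u LE) -(linear_extension_rank u LE').
apply: eq_card => v; rewrite !inE.
case: (chain_cases u) => [[i lti ->]|[i lti ->]];
  case: (chain_cases v) => [[j ltj ->]|[j ltj ->]].
- by rewrite !ltn_alpha.
- by rewrite !ltn_beta_alpha // eqh.
- by rewrite !ltn_alpha_beta // eqh.
- by rewrite !ltn_beta.
Qed.

(** * Realizing an admissible sequence by a linear extension *)

Section Realize.
Variable h : nat -> nat.
Hypothesis hadm : admissible h.

(* Lexicographic order on pairs (height, index), the elements of [beta] having
   the index [a], after all elements of [alpha] of the same height. *)
Let key u : nat := if u \in alpha then (h (index u alpha) * a.+1 + index u alpha)%N
  else (index u beta * a.+1 + a)%N.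

Let key_alpha i : (i < a)%N -> key (A i) = (h i * a.+1 + i)%N.
Proof.
by move=> lti; rewrite /key mem_nth ?index_uniq ?size_tuple ?lt_sorted_uniq.
Qed.

Let key_beta j : (j < b)%N -> key (B j) = (j * a.+1 + a)%N.
Proof.
move=> ltj; rewrite /key -[_ \in _]negbK notin_alpha mem_nth ?size_tuple //=.
by rewrite index_uniq ?size_tuple ?lt_sorted_uniq.
Qed.

Let key_alpha_lt i j : (i < a)%N -> (j < a)%N -> (key (A i) < key (A j))%N = (i < j)%N.
Proof.
have mono i1 i2 : (i1 <= i2)%N -> (i2 < a)%N -> (h i1 <= h i2)%N.
  case: hadm => hmono _ _ _; elim: i2 => [|i2 IH]; first by rewrite leqn0 => /eqP->.
  rewrite leq_eqVlt => /orP[/eqP-> //|le12] lt2.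
  by apply: leq_trans (hmono _ lt2); apply: IH; rewrite // (ltn_trans _ lt2).
move=> lti ltj; rewrite !key_alpha //.
have lt_lex m m' p q : (m <= m')%N -> (p < q)%N -> (m * a.+1 + p < m' * a.+1 + q)%N.
  by move=> le_m lt_pq; rewrite -addnS leq_add ?leq_mul2r ?le_m ?orbT.
case: (ltngtP i j) => [lt_ij|lt_ji|->]; last by rewrite ltnn.
  by apply: lt_lex => //; apply: mono ltj; apply: ltnW.
by apply/negbTE; rewrite -leqNgt ltnW // lt_lex // mono // ltnW.
Qed.

Let key_beta_alpha i j : (i < a)%N -> (j < b)%N ->
  (key (B j) < key (A i))%N = (j < h i)%N.
Proof. by move=> lti ltj; rewrite key_alpha ?key_beta //; nia. Qed.

Let key_inj : injective key.
Proof.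
move=> u v; case: (chain_cases u) => [[i lti ->]|[i lti ->]];
  case: (chain_cases v) => [[j ltj ->]|[j ltj ->]].
- move=> eqk; have := key_alpha_lt lti ltj; have := key_alpha_lt ltj lti.
  by rewrite eqk ltnn => ? ?; congr (A _); lia.
(* The residue modulo [a.+1] separates the chains: it is below [a] on [alpha] and equal to [a] on
   [beta]. *)
- by rewrite key_alpha ?key_beta // => /(congr1 (modn^~ a.+1)); rewrite /= !modnMDl !modn_small; lia.
- by rewrite key_alpha ?key_beta // => /(congr1 (modn^~ a.+1)); rewrite /= !modnMDl !modn_small; lia.
- by rewrite !key_beta // => ?; congr (B _); nia.
Qed.

Let key_mono u v : (u < v)%O -> (key u < key v)%N.
Proof.
case: hadm => _ _ lower upper.
case: (chain_cases u) => [[i lti ->]|[i lti ->]];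
  case: (chain_cases v) => [[j ltj ->]|[j ltj ->]].
- rewrite key_alpha_lt //; case: (ltngtP i j) => [//|lt_ji|->]; last by rewrite ltxx.
  by rewrite lt_gtF ?alpha_lt.
- by move=> /(upper _ _ lti ltj); rewrite key_alpha ?key_beta //; nia.
- by move=> /(lower _ _ ltj lti); rewrite key_beta_alpha.
- rewrite !key_beta //; case: (ltngtP i j) => [? _|lt_ji|->]; last by rewrite ltxx.
    by nia.
  by rewrite lt_gtF ?beta_lt.
Qed.

Lemma height_surj : exists2 L, linear_extension L &
  forall i, (i < a)%N -> height L i = h i.
Proof.
have [L LE LE_rank] := linear_extension_of_key key_inj key_mono.
exists L => // i lti; apply/eqP; rewrite -(eqn_add2l i) -linear_extension_height //.
rewrite LE_rank card_chains; apply/eqP; congr (_ + _)%N.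
  apply: (@count_nth_initial _ x); rewrite size_tuple ?(ltnW lti) //= => j ltj.
  exact: key_alpha_lt.
apply: (@count_nth_initial _ x); rewrite size_tuple; first by case: hadm => _ ->.
by move=> j ltj; rewrite -key_beta_alpha.
Qed.

End Realize.

(** * Monomials of linear extensions and coefficients of products *)

Definition qexp L : 'X_{1..a} :=
  [multinom (chain_pos alpha L i.+1 - chain_pos alpha L i)%N | i < a].

Lemma qweightE L : qweight alpha L = 'X_[qexp L].
Proof. by rewrite /qweight mpolyXE_id; apply: eq_bigr => i _; rewrite mnmE. Qed.

Lemma chain_posE L i : linear_extension L -> (i < a)%N ->
  chain_pos alpha L i.+1 = (i + height L i).+1.
Proof.
move=> LE lti; rewrite /chain_pos /= (nth_map x) ?size_tuple // /pos.
by rewrite linear_extension_height.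
Qed.

(** Exponents are differences of consecutive values [i + height L i + 1], hence affine in the
    heights; monotone heights make the truncated subtraction exact. The first exponent is separate
    because of the convention for [alpha_0]. *)
Lemma qexp_sum L1 L2 M1 M2 :
    linear_extension L1 -> linear_extension L2 ->
    linear_extension M1 -> linear_extension M2 ->
    (forall i, (i < a)%N ->
      (height L1 i + height L2 i = height M1 i + height M2 i)%N) ->
  (qexp L1 + qexp L2 = qexp M1 + qexp M2)%MM.
Proof.
move=> LE1 LE2 ME1 ME2 eqh; apply/mnmP => -[i lti]; rewrite !mnmDE !mnmE /=.
case: i lti => [|i] lti.
  by have := eqh _ lti; rewrite !chain_posE //= /chain_pos /=; lia.
have ltpi := ltn_trans (ltnSn i) lti.
have := eqh _ lti; have := eqh _ ltpi; rewrite !chain_posE //.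
have mono L : linear_extension L -> (height L i <= height L i.+1)%N.
  by move=> /height_admissible[+ _ _ _]; apply.
have := mono _ LE1; have := mono _ LE2; have := mono _ ME1; have := mono _ ME2.
by lia.
Qed.

(** The pairs contributing the monomial [m] to the product of [Nq alpha x k] and [Nq alpha x l],
    each with coefficient 1. *)
Definition ext_pairs (k l : nat) (m : 'X_{1..a}) :
    {pred {ffun X -> 'I_#|X|} * {ffun X -> 'I_#|X|}} :=
  [pred p | [&& linear_extension p.1 && (pos p.1 x == k),
                linear_extension p.2 && (pos p.2 x == l)
              & qexp p.1 + qexp p.2 == m]%MM].

Lemma mcoeff_NqM (k l : nat) (m : 'X_{1..a}) :
  (Nq alpha x k * Nq alpha x l)@_m = (#|ext_pairs k l m|)%:R.
Proof.
rewrite /Nq big_distrlr /= pair_big_dep /= raddf_sum /=.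
rewrite -[in RHS]sum1_card natr_sum [LHS]big_mkcond [RHS]big_mkcond /=.
apply: eq_bigr => -[L L'] _; rewrite !inE /= !qweightE -mpolyXD mcoeffX.
by case: (linear_extension L && _); case: (linear_extension L' && _); case: eqP.
Qed.

(** * The injection on pairs of linear extensions *)

Hypothesis hx : x \in alpha.
Let s := index x alpha.
Let lt_sa : (s < a)%N. Proof. by rewrite -[ltnRHS](size_tuple alpha) index_mem. Qed.
Let As : A s = x. Proof. exact: nth_index. Qed.

Let pos_x L : linear_extension L -> pos L x = (s + height L s).+1.
Proof. by move=> LE; rewrite /pos -{1}As linear_extension_height. Qed.

Lemma leq_ext_pairs k m : (1 < k)%N ->
  (#|ext_pairs k.-1 k.+1 m| <= #|ext_pairs k k m|)%N.
Proof.
move=> gt1k.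
pose R (p r : {ffun X -> 'I_#|X|} * {ffun X -> 'I_#|X|}) :=
  [forall i : 'I_a,
    (height r.1 i == reflect_lo s (height p.1) (height p.2) i) &&
    (height r.2 i == reflect_hi s (height p.1) (height p.2) i)].
have gap L L' : linear_extension L -> linear_extension L' -> pos L x = k.-1 ->
    pos L' x = k.+1 -> (height L' s = (height L s).+2)%N.
  by move=> LE LE'; rewrite !pos_x //; lia.
apply: (@leq_card_rel _ _ _ _ R).
  move=> [L L'] /and3P[/= /andP[LE /eqP Lx] /andP[LE' /eqP L'x] /eqP Lm].
  have gapL := gap _ _ LE LE' Lx L'x.
  have [mono ub lo up] := height_admissible LE.
  have [mono' ub' lo' up'] := height_admissible LE'.
  have gapL' : ((height L s).+2 <= height L' s)%N by rewrite gapL.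
  have rgap := @reflected_gap a s lt_sa _ _ mono mono' gapL'.
  have rmono := @reflect_mono a s lt_sa _ _ mono mono' gapL'.
  (* On the reflected interval both new values lie strictly between the heights of [L] and [L'], so
     lower bounds come from [L] and upper bounds from [L']. *)
  have [|M ME Mh] := @height_surj (reflect_lo s (height L) (height L')).
    split=> [i /rmono[]//|i lti|i j lti ltj ltBA|i j lti ltj ltAB]; rewrite /reflect_lo;
      case: ifPn => [/(rgap _ lti)|_].
    + by have := ub' _ lti; lia.
    + by have := ub _ lti; lia.
    + by have := lo _ _ lti ltj ltBA; lia.
    + by have := lo _ _ lti ltj ltBA; lia.
    + by have := up' _ _ lti ltj ltAB; lia.
    + by have := up _ _ lti ltj ltAB; lia.
  have [|M' ME' Mh'] := @height_surj (reflect_hi s (height L) (height L')).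
    split=> [i /rmono[]//|i lti|i j lti ltj ltBA|i j lti ltj ltAB]; rewrite /reflect_hi;
      case: ifPn => [/(rgap _ lti)|_].
    + by have := ub' _ lti; lia.
    + by have := ub' _ lti; lia.
    + by have := lo _ _ lti ltj ltBA; lia.
    + by have := lo' _ _ lti ltj ltBA; lia.
    + by have := up' _ _ lti ltj ltAB; lia.
    + by have := up' _ _ lti ltj ltAB; lia.
  exists (M, M'); last by apply/forallP => i; rewrite /= Mh // Mh' // !eqxx.
  rewrite !inE /= ME ME' !pos_x // Mh // Mh' // /reflect_lo /reflect_hi.
  (* The index [s] is always reflected, and a gap of exactly 2 sends both heights there to the
     midpoint, that is, [x] to position [k]. *)
  rewrite reflected_center gapL /=.
  have := Lx; have := L'x; rewrite !pos_x // => L'x1 Lx1.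
  apply/and3P; split; [by apply/eqP; lia | by apply/eqP; lia |].
  (* The sum of heights is kept, since [(h' - 1) + (h + 1) = h + h']. *)
  rewrite -Lm; apply/eqP/qexp_sum => // i lti; rewrite Mh // Mh' //.
  rewrite /reflect_lo /reflect_hi; case: ifPn => [/(rgap _ lti)|_]; lia.
(* Injectivity: two pairs related to the same image have equal reflections, hence equal heights. *)
move=> [L1 L2] [K1 K2] [M1 M2].
move=> /and3P[/= /andP[LE1 /eqP L1x] /andP[LE2 /eqP L2x] _].
move=> /and3P[/= /andP[KE1 /eqP K1x] /andP[KE2 /eqP K2x] _].
move=> /forallP RL /forallP RK.
have [mL1 _ _ _] := height_admissible LE1; have [mL2 _ _ _] := height_admissible LE2.
have [mK1 _ _ _] := height_admissible KE1; have [mK2 _ _ _] := height_admissible KE2.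
have eqh := reflect_inj lt_sa mL1 mL2 mK1 mK2 _ _ _ _.
have {}eqh i : (i < a)%N -> height L1 i = height K1 i /\ height L2 i = height K2 i.
  apply: eqh => [||j ltj|j ltj]; rewrite ?(gap _ _ LE1 LE2) ?(gap _ _ KE1 KE2) //.
    by have /andP[/eqP<- _] := RL (Ordinal ltj); have /andP[/eqP<- _] := RK (Ordinal ltj).
  by have /andP[_ /eqP<-] := RL (Ordinal ltj); have /andP[_ /eqP<-] := RK (Ordinal ltj).
by congr (_, _); apply: height_inj => // i /eqh[].
Qed.

End Heights.

Theorem theorem7p1 (d : Order.disp_t) (X : finPOrderType d)
    (hwidth : width X = 2%N)
    (a b : nat) (alpha : a.-tuple X) (beta : b.-tuple X)
    (halpha : sorted (fun u v : X => (u < v)%O) alpha)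
    (hbeta : sorted (fun u v : X => (u < v)%O) beta)
    (hcover : [set: X] = [set u in alpha] :|: [set u in beta])
    (hdisj : [disjoint [set u in alpha] & [set u in beta]])
    (x : X) (hx : x \in alpha)
    (k : nat) (hk : (1 < k)%N) :
  coef_le (Nq alpha x k.-1 * Nq alpha x k.+1) (Nq alpha x k ^+ 2).
Proof.
move=> m; rewrite expr2 !mcoeff_NqM ler_nat.
exact: leq_ext_pairs halpha hbeta hcover hdisj hx _ _ hk.
Qed.
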